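(* The set $\mathrm{L}(\omega)$ of all bounded real sequences having exactly countably infinitely many accumulation points is densely lineable in $\ell_\infty$; that is, $\mathrm{L}(\omega)\cup\{0\}$ contains a linear subspace of $\ell_\infty$ that is dense in $\ell_\infty$ (in the supremum norm).
   Context: $\ell_\infty$ is the real Banach space of bounded real sequences $x=(x(n))_{n\in\omega}$ with the supremum norm, where $\omega=\{0,1,2,\dots\}$ (also denoting the smallest infinite cardinal). For $x\in\ell_\infty$, a real $\eta$ is an accumulation point of $x$ if $\{n\in\omega: |x(n)-\eta|<\varepsilon\}$ is infinite for all $\varepsilon>0$; $\mathrm{L}_x$ denotes the set of accumulation points of $x$. For a cardinal $\kappa$, $\mathrm{L}(\kappa)=\{x\in\ell_\infty: |\mathrm{L}_x|=\kappa\}$. A subset $M$ of a topological vector space $X$ is densely lineable in $X$ if $M\cup\{0\}$ contains a linear subspace that is dense in $X$. *)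

(* Defs.v *)
From HB Require Import structures.
From mathcomp Require Import all_boot all_order all_algebra.
From mathcomp Require Import mathcomp_extra boolp classical_sets functions.
From mathcomp Require Import cardinality reals topology normedtype.

Set Implicit Arguments.
Unset Strict Implicit.
Unset Printing Implicit Defensive.

Import Order.TTheory GRing.Theory Num.Theory.
Import numFieldNormedType.Exports.

Local Open Scope classical_set_scope.
Local Open Scope card_scope.
Local Open Scope ring_scope.

Section linfty.
Context (R : realType).

Definition bounded_seq : {pred nat -> R} := mem (bounded_fun : set (nat -> R)).

Lemma bounded_seqP (x : nat -> R) :
  x \in bounded_seq <-> exists M, forall n, `|x n| <= M.
Proof.
have PF : ProperFilter (globally [set: nat]).
  by apply: (@globally_properfilter _ _ 0%N).
rewrite in_setE; split => [/(@ex_bound _ _ _ x)[M xM]|[M xM]].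
  by exists M => n; apply: xM.
by apply/(@ex_bound _ _ _ x); exists M => n _; apply: xM.
Qed.

Lemma bounded_seq_submod_closed : submod_closed bounded_seq.
Proof.
split=> [|a x y /bounded_seqP[M xM] /bounded_seqP[N yN]]; apply/bounded_seqP.
  by exists 0 => n; rewrite normr0.
exists (`|a| * M + N) => n.
by rewrite (le_trans (ler_normD _ _))// lerD// normrM ler_wpM2l.
Qed.

HB.instance Definition _ :=
  GRing.isSubmodClosed.Build R (nat -> R) bounded_seq bounded_seq_submod_closed.

Record linfty := Linfty {
  linfty_fun :> nat -> R;
  linfty_bounded : linfty_fun \in bounded_seq }.

HB.instance Definition _ := [isSub for linfty_fun].
HB.instance Definition _ := [Choice of linfty by <:].
HB.instance Definition _ := [SubChoice_isSubLmodule of linfty by <:].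

Definition linfty_norm (x : linfty) : R := sup (range (fun n => `|x n|)).

Lemma le_linfty_norm (x : linfty) n : `|x n| <= linfty_norm x.
Proof.
have /bounded_seqP[M xM] := linfty_bounded x.
by apply: ub_le_sup; [exists M => _ [k _ <-]|exists n].
Qed.

Lemma linfty_norm_le (x : linfty) (M : R) :
  (forall n, `|x n| <= M) -> linfty_norm x <= M.
Proof.
by move=> xM; apply: ge_sup => [|_ [k _ <-]//]; exists `|x 0%N|, 0%N.
Qed.

Lemma linfty_normD (x y : linfty) :
  linfty_norm (x + y) <= linfty_norm x + linfty_norm y.
Proof.
apply: linfty_norm_le => n.
by rewrite (le_trans (ler_normD _ _))// lerD ?le_linfty_norm.
Qed.

Lemma linfty_normZ (a : R) (x : linfty) :
  linfty_norm (a *: x) = `|a| * linfty_norm x.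
Proof.
apply/eqP; rewrite eq_le; apply/andP; split.
  by apply: linfty_norm_le => n; rewrite normrM ler_wpM2l ?le_linfty_norm.
have [->|a0] := eqVneq a 0.
  by rewrite normr0 mul0r (le_trans _ (le_linfty_norm _ 0%N)).
rewrite mulrC -ler_pdivlMr ?normr_gt0//; apply: linfty_norm_le => n.
by rewrite ler_pdivlMr ?normr_gt0// mulrC -normrM (le_linfty_norm (a *: x)).
Qed.

Lemma linfty_norm_eq0 (x : linfty) : linfty_norm x = 0 -> x = 0.
Proof.
move=> x0; apply/val_inj/funext => n /=.
by apply/eqP; rewrite -normr_le0 -x0 le_linfty_norm.
Qed.

HB.instance Definition _ :=
  Lmodule_isNormed.Build R linfty linfty_normD linfty_normZ linfty_norm_eq0.

Lemma linfty_normE (x : linfty) : `|x| = sup (range (fun n => `|x n|)).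
Proof. by []. Qed.

Definition accumulation_points (x : linfty) : set R :=
  [set eta | forall eps : R, 0 < eps ->
     infinite_set [set n | `|x n - eta| < eps]].

(* The cardinal is represented by any set K having that cardinality. *)
Definition Lset (T : Type) (K : set T) : set linfty :=
  [set x | accumulation_points x #= K].

End linfty.

Definition densely_lineable (R : numFieldType) (X : topologicalLmodType R)
    (M : set X) : Prop :=
  exists V : set X,
    [/\ submod_closed (mem V), V `<=` M `|` [set 0] & dense V].

(* Main.v *)
(** A finite sum of bounded sequences with finite range has finite range, so it
    suffices to perturb such sequences slightly by "independent" null families.
    Spread the finite words over nat so that each word sits at infinitely many
    positions. To s : nat -> nat attach the sequence equal to 1 / (n + 1) at the
    positions carrying the length-n prefix of s, and to 0 elsewhere. Distinct
    branches have eventually disjoint sets of prefixes, so a nontrivial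
    combination of these takes, for some d <> 0 and all large n, the value
    d / (n + 1) infinitely often; adding a finite-range sequence, infinitely many
    accumulation points remain. There are only countably many, because they all
    lie in the closure of a finite union of sets {v + b / (n + 1) : n}.
    There are enough branches for s to encode in addition the finite-range
    sequence to be perturbed and the size 1 / (s 0 + 1) of the perturbation. *)
Require Import Defs.
From mathcomp Require Import all_boot all_order all_algebra.
From mathcomp Require Import classical_sets cardinality reals topology normedtype.
From mathcomp Require Import boolp functions sequences ring lra.

Local Open Scope classical_set_scope.

Set Implicit Arguments.
Unset Strict Implicit.
Unset Printing Implicit Defensive.

Import Order.TTheory GRing.Theory Num.Theory.
Import numFieldNormedType.Exports.

Local Open Scope ring_scope.

(** * Pigeonhole and finite-range functions *)

Lemma infinite_fiber (T U : Type) (A : set T) (f : T -> U) :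
  infinite_set A -> finite_set (f @` A) ->
  exists u, infinite_set (A `&` [set t | f t = u]).
Proof.
move=> Ainf fA; apply: contrapT => /forallNP nfib; apply: Ainf.
have -> : A = \bigcup_(u in f @` A) (A `&` [set t | f t = u]).
  by apply/seteqP; split=> [t At|t [u _ []//]]; exists (f t) => //; exists t.
by apply: bigcup_finite => // u _; apply: contrapT; exact: nfib.
Qed.

Lemma finite_range_comp2 (T U V W : Type) (f : U -> V -> W) (g : T -> U)
    (h : T -> V) :
  finite_set (range g) -> finite_set (range h) ->
  finite_set (range (fun t => f (g t) (h t))).
Proof.
move=> fg fh; have := finite_image (fun p => f p.1 p.2) (finite_setX fg fh).
apply: sub_finite_set => _ [t _ <-].
by exists (g t, h t) => //=; split; exists t.
Qed.

Lemma finite_range_sum (T I : Type) (V : nmodType) (r : seq I)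
    (f : I -> T -> V) :
  (forall i, finite_set (range (f i))) ->
  finite_set (range (fun t => \sum_(i <- r) f i t)).
Proof.
move=> ff; elim: r => [|i r IH].
  apply: (@sub_finite_set _ _ [set 0]) => // _ [t _ <-].
  by rewrite big_nil.
rewrite (_ : (fun t => _) = (fun t => f i t + \sum_(j <- r) f j t)).
  exact: (finite_range_comp2 (fun x y => x + y)).
by apply/funext => t; rewrite big_cons.
Qed.

Lemma sum_uniq_widen (I : eqType) (V : nmodType) (r r' : seq I) (f : I -> V) :
  uniq r -> uniq r' -> {subset r <= r'} ->
  \sum_(i <- r') (if i \in r then f i else 0) = \sum_(i <- r) f i.
Proof.
move=> ur ur' rr'; rewrite -big_mkcond -big_filter; apply: perm_big.
apply: uniq_perm => [|//|i]; first exact: filter_uniq.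
by rewrite mem_filter; case ri : (i \in r) => //=; exact: rr'.
Qed.

(** A point [x] outside is at positive distance from [l]. All but finitely many terms lie in the
    closed ball around [l] of half that radius, so a finite set together with this ball is closed,
    contains everything, and misses [x]. *)
Lemma closed_cvg_range (R : realType) (u : nat -> R) (l : R) :
  u @ \oo --> l -> closed (range u `|` [set l]).
Proof.
move=> ul x clx; apply: contrapT => /not_orP[xu xl].
have e0 : 0 < `|x - l| / 2 by rewrite divr_gt0// normr_gt0 subr_eq0; exact/eqP.
have [N _ Nu] : \forall n \near \oo, `|l - u n| < `|x - l| / 2.
  by move/cvgrPdist_lt: ul; apply.
pose C := u @` `I_N `|` [set y | `|l - y| <= `|x - l| / 2].
have clC : closed C.
  apply: closedU.
    have /hausdorff_accessible/accessible_finite_set_closed := @Rhausdorff R.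
    by apply; exact/finite_image/finite_II.
  have := @closed_ball_closed R R l (`|x - l| / 2).
  by rewrite closed_ballE.
have : C x.
  apply: clC; apply: closureS clx => _ [[n _ <-]|->].
    have [nN|Nn] := ltnP n N; first by left; exists n.
    by right; apply/ltW/Nu.
  by right; rewrite /= subrr normr0 ltW.
case=> [[n _ unx]|/=]; first by apply: xu; exists n.
rewrite distrC; lra.
Qed.

(** * Accumulation points of a finite-range perturbation *)

Section accumulation.
Context (R : realType) (x : linfty R) (g b : nat -> R) (h : nat -> nat).
Context (u : nat -> R).
Hypotheses (fin_g : finite_set (range g)) (fin_b : finite_set (range b)).
Hypothesis xE : forall m, x m = g m + b m * u (h m).

Lemma accumulation_points_countable :
  u @ \oo --> 0 -> countable (accumulation_points x).
Proof.
move=> u0; pose D := range g `*` range b.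
have fD : finite_set D by exact: finite_setX.
pose F (p : R * R) := range (fun k => p.1 + p.2 * u k) `|` [set p.1].
have clF : closed (\bigcup_(p in D) F p).
  apply: closed_bigcup => // p _; apply: closed_cvg_range.
  rewrite -[X in _ --> X]addr0 -[X in _ --> _ + X](mulr0 p.2).
  by apply: cvgD; [exact: cvg_cst|apply: cvgMl_tmp].
apply: (@sub_countable _ _ _ (\bigcup_(p in D) F p)); last first.
  (* Each [F p] is enumerated by [option nat], with [None] giving the limit [p.1]. *)
  apply: bigcup_countable => [|p _]; first exact: finite_set_countable.
  apply: (@sub_countable _ _ _
      (range (oapp (fun k => p.1 + p.2 * u k) p.1))); last first.
    exact: sub_countable (card_image_le _ _) (countableP _).
  apply: subset_card_le => _ [[k _ <-]|->]; [by exists (Some k)|by exists None].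
apply: subset_card_le => eta acc_eta; apply: clF => B /nbhs_ballP[e e0 eB].
have [m /= xm] := infinite_setN0 (acc_eta e e0).
exists (x m); split; last by apply: eB; rewrite /ball /= distrC.
exists (g m, b m); first by split; exists m.
by left; exists (h m) => //=; rewrite xE.
Qed.

(** Pigeonhole twice. For each [n >= N] some value [v n] of [g] recurs, so [v n + d * u n] is
    attained infinitely often. Were there finitely many accumulation points, infinitely many [n]
    would share both [v n] and [v n + d * u n], against injectivity of [u]. *)
Lemma accumulation_points_infinite (d : R) (N : nat) :
  d != 0 -> injective u ->
  (forall n, (N <= n)%N -> infinite_set [set m | h m = n /\ b m = d]) ->
  infinite_set (accumulation_points x).
Proof.
move=> d0 uinj infm finL.
have /choice[v vP] n : exists v, (N <= n)%N ->
    range g v /\ accumulation_points x (v + d * u n).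
  have [Nn|_] := leqP N n; last by exists 0.
  have [|v vinf] := infinite_fiber (f := g) (infm _ Nn).
    by apply: sub_finite_set fin_g => _ [m _ <-]; exists m.
  exists v => _; split.
    by have [m [_ <-]] := infinite_setN0 vinf; exists m.
  move=> e e0; apply: sub_infinite_set vinf => m /= [[hm bm] gm].
  by rewrite xE hm bm gm subrr normr0.
pose A := [set n | (N <= n)%N].
have Ainf : infinite_set A.
  apply: sub_infinite_set (infinite_setD infinite_nat (finite_II N)) => n.
  by move=> [_ /negP]; rewrite -leqNgt.
have [|[w eta] fib] := infinite_fiber (f := fun n => (v n, v n + d * u n)) Ainf.
  apply: sub_finite_set (finite_setX fin_g finL) => _ [n /vP[gv vn] <-].
  by split.
have [n fn] := infinite_setN0 fib; apply: fib.
apply: (@sub_finite_set _ _ [set n]) => // k.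
move: fn => [_ [vn en]] [_ [vk ek]]; apply: uinj; apply: (mulfI d0).
by apply: (@addrI _ w); rewrite -[in LHS]vk ek -en vn.
Qed.

End accumulation.

(** The discarded first component is a counter that makes every word recur infinitely often. *)
Definition word (m : nat) : seq nat :=
  if unpickle m is Some p then (p : nat * seq nat).2 else [::].

Lemma infinite_word (w : seq nat) : infinite_set [set m | word m = w].
Proof.
move=> fin_w; apply: infinite_nat.
have inj : injective (fun j : nat => pickle (j, w)).
  by move=> i j /(pcan_inj (@pickleK (nat * seq nat)%type))[].
apply: sub_finite_set (finite_preimage (in2W inj) fin_w) => j _.
by rewrite /preimage /= /word pickleK.
Qed.

Lemma prefix_separation (r : seq (nat -> nat)) (s : nat -> nat) :
  exists N, forall t, t \in r -> forall n, (N <= n)%N ->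
    mkseq t n = mkseq s n -> t = s.
Proof.
elim: r => [|t r [N rN]]; first by exists 0%N.
have [->|ts] := eqVneq t s.
  exists N => t'; rewrite inE => /predU1P[->//|]; exact: rN.
have [k tk] : exists k, t k <> s k.
  by apply/existsNP => ts'; move/eqP: ts; apply; exact/funext.
(* A prefix longer than [k] shows entry [k], where [t] and [s] differ. *)
exists (maxn N k.+1) => t'; rewrite inE => /predU1P[->|t'r] n; rewrite geq_max.
  move=> /andP[_ kn] /(congr1 (fun w => nth 0%N w k)).
  by rewrite !nth_mkseq.
by move=> /andP[Nn _]; exact: rN.
Qed.

Lemma trunc_grid_dist (R : realType) (q y : R) : 0 < q -> `|y| <= q ->
  `|y - ((Num.truncn (q * (y + q)))%:R * q^-1 - q)| <= q^-1.
Proof.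
move=> q0; rewrite ler_norml => /andP[yl yu].
have t0 : 0 <= q * (y + q) by apply: mulr_ge0; lra.
have /andP[] := truncn_itv t0; rewrite -natr1; set t := _%:R => tl tu.
have -> : y - (t * q^-1 - q) = (q * (y + q) - t) / q.
  by field; rewrite gt_eqF.
rewrite ger0_norm ?divr_ge0 ?subr_ge0 ?(ltW q0)//.
by rewrite ler_piMl ?invr_ge0 ?(ltW q0)//; lra.
Qed.

(** * The generators and their span *)

Section generators.
Context (R : realType).
Implicit Types (s : nat -> nat) (m : nat).

(* With q = s 0 + 1, the value is the point of index s (m + 1) of the grid of
   mesh 1 / q in [-q, q]; the minimum keeps it in this interval for every s. *)
Definition grid s m : R :=
  (minn (s m.+1) (2 * (s 0).+1 ^ 2))%:R * harmonic (s 0%N) - (s 0%N).+1%:R.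

(** The decaying factor is left to [generator_fun], so that this part has finite range. *)
Definition on_branch s m : R :=
  harmonic (s 0%N) * (word m == mkseq s (size (word m)))%:R.

Definition generator_fun s m : R :=
  grid s m + on_branch s m * harmonic (size (word m)).

Lemma finite_range_grid s : finite_set (range (grid s)).
Proof.
pose K := (2 * (s 0%N).+1 ^ 2)%N.
apply: (@sub_finite_set _ _
    ((fun k => k%:R * harmonic (s 0%N) - (s 0%N).+1%:R) @` `I_K.+1)).
  by move=> _ [m _ <-]; exists (minn (s m.+1) K) => //=; rewrite ltnS geq_minr.
exact/finite_image/finite_II.
Qed.

Lemma finite_range_on_branch s : finite_set (range (on_branch s)).
Proof.
apply: (@sub_finite_set _ _ (range (fun c : bool => harmonic (s 0%N) * c%:R))).
  by move=> _ [m _ <-]; exists (word m == mkseq s (size (word m))).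
exact/finite_image/finite_finset.
Qed.

Lemma harmonic_itv n : 0 < (harmonic n : R) <= 1.
Proof. by rewrite /= invr_gt0 ltr0n /= invf_le1 ?ler1n ?ltr0n. Qed.

Lemma on_branch_dist s m :
  `|on_branch s m * harmonic (size (word m))| <= harmonic (s 0%N).
Proof.
have /andP[p0 p1] := harmonic_itv (s 0%N).
have /andP[q0 q1] := harmonic_itv (size (word m)).
rewrite /on_branch; case: eqP => _; last by rewrite mulr0 mul0r normr0 ltW.
rewrite mulr1 (ger0_norm (mulr_ge0 (ltW p0) (ltW q0))).
exact: ler_piMr (ltW p0) q1.
Qed.

Lemma generator_bounded s : generator_fun s \in @bounded_seq R.
Proof.
apply/bounded_seqP.
have [M MP] : exists M, forall m, `|grid s m| <= M.
  have /finite_seqP[l lP] := finite_range_grid s.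
  exists (\sum_(y <- l) `|y|) => m.
  have ml : [set` l] (grid s m) by rewrite -lP; exists m.
  by rewrite (big_rem _ ml)/= lerDl sumr_ge0.
exists (M + harmonic (s 0%N)) => m.
by rewrite (le_trans (ler_normD _ _))// lerD// on_branch_dist.
Qed.

Definition generator s : linfty R := Linfty (generator_bounded s).

(** As [r] has no repetitions, [c s] is the whole coefficient of [generator s]. *)
Definition span_generators : set (linfty R) :=
  [set x | exists (r : seq (nat -> nat)) (c : (nat -> nat) -> R),
    uniq r /\ x = \sum_(s <- r) c s *: generator s].

Lemma span_generators_submod_closed : submod_closed (mem span_generators).
Proof.
split=> [|a x y].
  by apply/mem_set; exists [::], (fun=> 0); rewrite big_nil.
move=> /set_mem[r1 [c1 [u1 ->]]] /set_mem[r2 [c2 [u2 ->]]]; apply/mem_set.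
(* Both combinations are extended by zero coefficients to a common list. *)
pose r := undup (r1 ++ r2).
exists r, (fun s => a * (if s \in r1 then c1 s else 0) +
  (if s \in r2 then c2 s else 0)); split; first exact: undup_uniq.
rewrite -(@sum_uniq_widen _ _ r1 r)//; last 2 first.
- exact: undup_uniq.
- by move=> s sr1; rewrite mem_undup mem_cat sr1.
rewrite -(@sum_uniq_widen _ _ r2 r)//; last 2 first.
- exact: undup_uniq.
- by move=> s sr2; rewrite mem_undup mem_cat sr2 orbT.
rewrite scaler_sumr -big_split; apply: eq_bigr => s _ /=.
rewrite scalerDl -scalerA; congr (_ *: _ + _); case: ifP => // _;
  by rewrite scale0r.
Qed.

Lemma linfty_sumE (I : Type) (r : seq I) (f : I -> linfty R) m :
  (\sum_(i <- r) f i : linfty R) m = \sum_(i <- r) f i m.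
Proof. by elim/big_rec2: _ => // i y x _ <-. Qed.

Lemma span_generators_Lset :
  span_generators `<=` Lset (R := R) [set: nat] `|` [set 0].
Proof.
move=> x [r [c [ur xE]]]; have [->|x0] := eqVneq x 0; [by right|left].
have [s sr cs] : exists2 s, s \in r & c s != 0.
  apply: contrapT => /forall2NP nc; move/eqP: x0; apply.
  rewrite xE big_seq big1//.
  by move=> s sr; have [//|/negP/negPn/eqP->] := nc s; rewrite scale0r.
pose g m := \sum_(s <- r) c s * grid s m.
pose b m := \sum_(s <- r) c s * on_branch s m.
have fin_g : finite_set (range g).
  apply: finite_range_sum => t.
  exact: (finite_range_comp2 (fun y _ => c t * y) (finite_range_grid t)
    (finite_range_grid t)).
have fin_b : finite_set (range b).
  apply: finite_range_sum => t.
  exact: (finite_range_comp2 (fun y _ => c t * y) (finite_range_on_branch t)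
    (finite_range_on_branch t)).
have xgb m : x m = g m + b m * harmonic (size (word m)).
  rewrite xE linfty_sumE mulr_suml -big_split; apply: eq_bigr => t _ /=.
  by rewrite -mulrA -mulrDr.
apply: eq_card_nat.
  apply: (accumulation_points_countable fin_g fin_b xgb).
  exact: cvg_harmonic.
have [N sepN] := prefix_separation r s.
apply: (accumulation_points_infinite fin_g xgb
  (d := c s * harmonic (s 0%N)) (N := N)).
- by rewrite mulf_neq0// gt_eqF//; have /andP[] := harmonic_itv (s 0%N).
- by move=> i j /= /invr_inj/eqP; rewrite eqr_nat => /eqP[].
move=> n Nn.
apply: (sub_infinite_set _ (@infinite_word (mkseq s n))) => m /= wm.
have hm : size (word m) = n by rewrite wm size_mkseq.
(* Where the word is the length-[n] prefix of [s], every other branch in [r] contributes zero to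
   [b]. *)
split=> //; rewrite /b (bigD1_seq s)//= {1}/on_branch hm wm eqxx mulr1.
rewrite big_seq_cond big1 ?addr0// => t /andP[tr ts].
rewrite /on_branch hm wm; case: eqP => [/esym/(sepN t tr n Nn) tsE|_].
  by rewrite tsE eqxx in ts.
by rewrite !mulr0.
Qed.

Lemma span_generators_dense : dense span_generators.
Proof.
move=> O [x Ox] Oop.
have /nbhs_ballP[e e0 eO] : nbhs x O by exact: open_nbhs_nbhs.
have /bounded_seqP[M xM] := linfty_bounded x.
(* [q > M + 2 / e] ensures both that the grid interval [[-q, q]] contains all values of [x] and that
   [2 / q < e]. *)
pose p := Num.truncn (M + 2 / e); pose q := p.+1%:R : R.
have M0 : 0 <= M by rewrite (le_trans _ (xM 0%N)).
have e20 : 0 < 2 / e by rewrite divr_gt0.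
have /andP[_ q_gt] : p%:R <= M + 2 / e < q.
  exact/truncn_itv/(addr_ge0 M0 (ltW e20)).
have q0 : 0 < q by rewrite ltr0n.
pose s k := if k is m.+1 then Num.truncn (q * (x m + q)) else p.
exists (generator s); split; last first.
  exists [:: s], (fun=> 1); split => //.
  by rewrite big_seq1 scale1r.
apply: eO; rewrite -ball_normE /=.
(* One [1 / q] pays for rounding to the grid, the other for the branch term. *)
apply: (@le_lt_trans _ _ (2 / q)); last first.
  rewrite ltr_pdivrMr// mulrC -ltr_pdivrMr//; lra.
apply: linfty_norm_le => m.
rewrite (_ : (x - _ : linfty R) m = x m - generator_fun s m)//.
have -> : x m - generator_fun s m =
  (x m - grid s m) - on_branch s m * harmonic (size (word m)).
  by rewrite /generator_fun opprD addrA.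
rewrite (le_trans (ler_normB _ _))//.
rewrite mulr_natl mulr2n.
apply: lerD; last exact: on_branch_dist.
have yq : `|x m| <= q.
  by rewrite (le_trans (xM m))// (le_trans _ (ltW q_gt))// lerDl ltW.
rewrite /grid /= -/q (minn_idPl _); first exact: trunc_grid_dist.
(* The index is at most [q * (x m + q) <= 2 * q ^ 2], so the cap in [grid] is inactive. *)
have := yq; rewrite ler_norml => /andP[xl xu].
have t0 : 0 <= q * (x m + q) by apply: mulr_ge0; lra.
have /andP[tl _] := truncn_itv t0.
rewrite -(ler_nat R) (le_trans tl)// natrM natrX -/q expr2 mulrCA.
by rewrite ler_wpM2l ?(ltW q0)// mulr_natl mulr2n lerD2r.
Qed.

End generators.

Theorem theorem3p4 (R : realType) :
  densely_lineable (Lset (R := R) [set: nat]).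
Proof.
exists (@span_generators R); split.
- exact: span_generators_submod_closed.
- exact: span_generators_Lset.
- exact: span_generators_dense.
Qed.
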